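(* For any two polytopes $P$ and $Q$ in the same Euclidean space, $$\delta(P+Q)<\min\left\{(\delta(P)+1)f_0(Q),\ f_0(P)(\delta(Q)+1)\right\}.$$
   Context: A polytope is the (nonempty) convex hull of finitely many points. $P+Q=\{p+q : p\in P,\ q\in Q\}$ is the Minkowski sum. $f_0(P)$ is the number of vertices of $P$. The graph of a polytope is the graph made up of its vertices and edges ($0$- and $1$-dimensional faces), and the diameter $\delta(P)$ of a polytope $P$ is the diameter of its graph, i.e. the largest graph distance between two of its vertices. *)

(* Defs.v *)
From mathcomp Require Import all_boot all_order all_algebra finmap.
From mathcomp Require Import boolp classical_sets cardinality reals ereal convex.

Set Implicit Arguments.
Unset Strict Implicit.
Unset Printing Implicit Defensive.

Import Order.TTheory GRing.Theory Num.Theory.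
Local Open Scope classical_set_scope.
Local Open Scope ring_scope.

Section Polytopes.
Context {R : realType} {n : nat}.
Local Notation E := 'rV[R]_n.

Definition convex_hull (A : set E) : set E := smallest (@convex_set R E) A.

Definition polytope (P : set E) : Prop :=
  exists2 V : seq E, V != [::] & P = convex_hull [set` V].

Definition minkowski_sum (P Q : set E) : set E :=
  [set p + q | p in P & q in Q].

Definition affine_set (A : set E) : Prop :=
  forall (t : R) (x y : E), A x -> A y -> A (t *: x + (1 - t) *: y).

Definition affine_hull (A : set E) : set E := smallest affine_set A.

(* No natural number is a dimension of the empty set. *)
Definition has_dim (A : set E) (d : nat) : Prop :=
  exists (x : E) (U : {vspace E}),
    affine_hull A = [set x + u | u in [set` U]] /\ \dim U = d.

Definition dotp (c x : E) : R := \sum_(i < n) c 0 i * x 0 i.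

(* Taking c = 0 makes P itself, and the empty set, faces of P. *)
Definition face (P F : set E) : Prop :=
  exists (c : E) (b : R),
    (forall x, P x -> dotp c x <= b) /\ F = P `&` [set x | dotp c x = b].

Definition kface (P : set E) (k : nat) (F : set E) : Prop :=
  face P F /\ has_dim F k.

Definition vertices (P : set E) : set E := [set v | kface P 0 [set v]].

(* fset_set returns the empty finite set on infinite sets; the vertex set of a
   polytope is finite, so this is the genuine number of vertices there. *)
Definition f0 (P : set E) : nat := #|` fset_set (vertices P)|.

Definition adjacent (P : set E) (u v : E) : Prop :=
  [/\ vertices P u, vertices P v, u <> v &
      exists2 F, kface P 1 F & F u /\ F v].

End Polytopes.

(* The distance is +oo between vertices that no path connects. *)
Definition graph_dist (R : realType) (T : eqType) (e : T -> T -> Prop) (u v : T)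
    : \bar R :=
  ereal_inf [set (size s)%:R%:E | s in
    [set s : seq T | path (fun x y => `[< e x y >]) u s /\ last u s = v]].

Definition diameter {R : realType} {n : nat} (P : set 'rV[R]_n) : \bar R :=
  ereal_sup [set graph_dist R (adjacent P) u v |
    u in vertices P & v in vertices P].

(* Main.v *)
Require Import Defs.
From mathcomp Require Import all_boot all_order all_algebra.
From mathcomp Require Import boolp classical_sets cardinality.
From mathcomp Require Import reals ereal convex.
From mathcomp Require Import ring lra.

(** Every vertex w of P + Q is the unique maximizer of some linear functional
    c, and then w = u + q where u and q are the unique maximizers of c on P and
    on Q.  Thus w lies over a well-defined vertex u of P, and the vertices of
    P + Q over u correspond to vertices q of Q, so there are at most f0 Q of
    them.  Two facts are needed:

    - the vertices of P + Q over a fixed vertex u induce a connected subgraph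
      ([fiber_path]), in which a simple path visits at most f0 Q vertices;
    - if u and v are adjacent in P, some edge of P + Q joins a vertex over u to
      a vertex over v ([edge_lift]).

    Lifting a path of P with k edges edge by edge, and moving inside the fibers
    in between, yields a path of P + Q with at most (k + 1) * f0 Q vertices
    ([path_lift]), hence with at most (k + 1) * f0 Q - 1 edges.  Taking k to be
    a distance in the graph of P, which is at most the diameter of P, gives the
    strict bound; the other bound follows from P + Q = Q + P.

    Both facts, and the connectedness of the graph of a polytope, come from one
    statement about a single polytope ([shadow_path]).  Let U be the open cone
    of the functionals that are positive on a given finite list of vectors.  If
    c0 and c1 in U have unique maximizers w0 and w1, then w0 and w1 are joined
    by a path all of whose vertices are unique maximizers of functionals of U.
    This is the shadow vertex form of the simplex method: perturb c1 inside U
    to a generic d, and follow the maximizer of c0 + t d as t grows from 0 to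
    infinity.  For generic d the maximizer only changes at values of t where
    the maximal face is an edge.  In [fiber_path] the cone U is the open normal
    cone of u; in [edge_lift] it consists of functionals whose maximum on P can
    be attained only at u or v among the vertices, so that the path from a
    vertex over u to a vertex over v must contain the desired edge. *)

Set Implicit Arguments.
Unset Strict Implicit.
Unset Printing Implicit Defensive.

Import Order.TTheory GRing.Theory Num.Theory.
Local Open Scope classical_set_scope.
Local Open Scope ring_scope.

(** * Sequences and paths *)

Lemma seq_argmin (T : eqType) (R : realType) (f : T -> R) (s : seq T) :
  s != [::] -> exists2 x, x \in s & forall y, y \in s -> f x <= f y.
Proof.
elim: s => // a s IH _; have [->|/IH[x xs xmin]] := eqVneq s [::].
  by exists a => [|y]; rewrite inE // => /eqP->.
have [ax|xa] := leP (f a) (f x).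
  exists a => [|y]; rewrite inE ?eqxx // => /predU1P[->//|/xmin].
  exact: le_trans.
exists x => [|y]; rewrite inE ?xs ?orbT // => /predU1P[->|/xmin//].
exact: ltW.
Qed.

Lemma path_crossing (T : eqType) (e : rel T) (A B : T -> Prop) x s :
    path e x s -> A x -> B (last x s) ->
    (forall y, y \in x :: s -> A y \/ B y) -> (forall y, A y -> ~ B y) ->
  exists a b, [/\ A a, B b & e a b].
Proof.
elim: s x => [x _ Ax Bx _ AB|y s IH x /= /andP[exy ps] Ax Bl sAB AB].
  by case: (AB x Ax).
have [Ay|By] : A y \/ B y by apply: sAB; rewrite !inE eqxx orbT.
  by apply: (IH y) => // z zs; apply: sAB; rewrite inE zs orbT.
by exists x, y.
Qed.

(** * Linear functionals and their perturbations *)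

Section LinearFunctionals.
Context {R : realType} {n : nat}.
Local Notation E := 'rV[R]_n.
Implicit Types (c d x y w : E) (L Z W : seq E).

Lemma dotpDr c x y : dotp c (x + y) = dotp c x + dotp c y.
Proof. by rewrite /dotp -big_split; apply: eq_bigr => i _; rewrite mxE mulrDr. Qed.

Lemma dotpZr c t x : dotp c (t *: x) = t * dotp c x.
Proof. by rewrite /dotp mulr_sumr; apply: eq_bigr => i _; rewrite mxE mulrCA. Qed.

Lemma dotpC c x : dotp c x = dotp x c.
Proof. by apply: eq_bigr => i _; rewrite mulrC. Qed.

Lemma dotpDl c d x : dotp (c + d) x = dotp c x + dotp d x.
Proof. by rewrite dotpC dotpDr !(dotpC x). Qed.

Lemma dotpZl c t x : dotp (t *: c) x = t * dotp c x.
Proof. by rewrite dotpC dotpZr (dotpC x). Qed.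

Lemma dotpNr c x : dotp c (- x) = - dotp c x.
Proof. by rewrite -scaleN1r dotpZr mulN1r. Qed.

Definition dotpE := (dotpDr, dotpNr, dotpZr, dotpDl, dotpZl).

Lemma dotp_gt0 x : x != 0 -> 0 < dotp x x.
Proof.
move=> x0; rewrite lt_neqAle sumr_ge0 ?andbT => [|i _]; last by rewrite -expr2 sqr_ge0.
apply: contra x0; rewrite eq_sym psumr_eq0 => [/allP x0|i _]; last first.
  by rewrite -expr2 sqr_ge0.
apply/eqP/rowP => i; rewrite mxE.
by have /(_ i) := x0; rewrite mem_index_enum mulf_eq0 orbb => /(_ isT)/eqP.
Qed.

Definition positive_on L c := forall x, x \in L -> 0 < dotp c x.

(** Moving c slightly towards d breaks the ties of c in favour of d. The whole
    interval of admissible steps is kept so that the bounds for the individual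
    vectors of L can be combined by taking their minimum. *)
Lemma lex_perturbation L c d :
    (forall x, x \in L -> 0 < dotp c x \/ dotp c x = 0 /\ 0 < dotp d x) ->
  exists2 e0 : R, 0 < e0 &
    forall e, 0 < e <= e0 -> positive_on L (c + e *: d).
Proof.
elim: L => [|x L IH] cL; first by exists 1 => // e _ y; rewrite in_nil.
have [y yL|e0 e0gt0 e0L] := IH; first by apply: cL; rewrite inE yL orbT.
have [e1 e1gt0 e1x] : exists2 e1 : R, 0 < e1 &
    forall e, 0 < e <= e1 -> 0 < dotp (c + e *: d) x.
  case: (cL x) => [|cx|[cx dx]]; first by rewrite inE eqxx.
  - have D0 : 0 < `|dotp d x| + 1 by rewrite ltr_wpDl.
    exists (dotp c x / (`|dotp d x| + 1)) => [|e /andP[e0']]; first exact: divr_gt0.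
    rewrite ler_pdivlMr // !dotpE => le_e.
    have : - (e * dotp d x) <= e * `|dotp d x|.
      by rewrite -mulrN ler_pM2l // ler_normr lexx orbT.
    lra.
  - by exists 1 => // e /andP[e0' _]; rewrite !dotpE cx add0r mulr_gt0.
exists (Num.min e0 e1) => [|e]; first by rewrite lt_min e0gt0.
rewrite le_min => /and3P[egt0 ee0 ee1] y; rewrite inE => /predU1P[->|].
  by apply: e1x; rewrite egt0.
by apply: e0L; rewrite egt0.
Qed.

(** Genericity inside an open cone: a vector z of Z orthogonal to the current
    functional is fixed by moving the functional slightly towards z. From then
    on the sign obtained on z is one more strict inequality to be preserved,
    which is why a nonzero multiple of z joins L in the induction. *)
Lemma generic_perturbation L Z c : positive_on L c -> 0 \notin Z ->
  exists2 c', positive_on L c' & forall z, z \in Z -> dotp c' z != 0.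
Proof.
elim: Z L c => [|z Z IH] L c cL; first by exists c.
rewrite inE negb_or eq_sym => /andP[z0 Z0].
have [s [c1 c1L c1z]] :
    exists s : R, exists2 c1, positive_on L c1 & 0 < dotp c1 (s *: z).
  have [cz|cz] := eqVneq (dotp c z) 0; last first.
    (* Scaling z by dotp c z turns its value under c into a square. *)
    by exists (dotp c z), c; rewrite // dotpZr -expr2 lt0r sqr_ge0 sqrf_eq0 cz.
  have [x|e e0 /(_ e)] := @lex_perturbation (z :: L) c z.
    rewrite inE => /predU1P[->|/cL]; last by left.
    by right; split=> //; apply: dotp_gt0.
  rewrite e0 lexx => /(_ isT) ce; exists 1, (c + e *: z).
    by move=> x xL; apply: ce; rewrite inE xL orbT.
  by rewrite scale1r ce // inE eqxx.
have [x|c2 c2L c2Z] := IH ((s *: z) :: L) c1 _ Z0.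
  by rewrite inE => /predU1P[->|/c1L].
exists c2 => [x xL|x]; first by apply: c2L; rewrite inE xL orbT.
rewrite inE => /predU1P[->|]; last exact: c2Z.
have /c2L : s *: z \in s *: z :: L by rewrite inE eqxx.
by rewrite dotpZr; apply: contraTneq => ->; rewrite mulr0 ltxx.
Qed.

End LinearFunctionals.

(** * Faces of convex hulls *)

Section Faces.
Context {R : realType} {n : nat}.
Local Notation E := 'rV[R]_n.
Implicit Types (A P Q : set E) (c d x y w : E) (L Z W : seq E).

Lemma convex_setP A :
  @convex_set R E A <->
  forall (t : R) x y, 0 <= t <= 1 -> A x -> A y -> A (t *: x + (1 - t) *: y).
Proof.
split=> [cA t x y /andP[t0 t1] Ax Ay|cA x y t]; last first.
  by rewrite !inE => Ax Ay; apply: cA => //; apply/andP.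
have := cA x y (Itv01 t0 t1); rewrite !inE; exact.
Qed.

Lemma convex_hull_convex A (t : R) x y : 0 <= t <= 1 ->
  convex_hull A x -> convex_hull A y -> convex_hull A (t *: x + (1 - t) *: y).
Proof.
move=> t01 Ax Ay B BA.
by move/convex_setP: (BA.1); apply=> //; [apply: Ax|apply: Ay].
Qed.

Lemma sub_convex_hull A : A `<=` convex_hull A.
Proof. exact: sub_gen_smallest. Qed.

Lemma convex_hull_min A B :
    (forall (t : R) x y, 0 <= t <= 1 -> B x -> B y -> B (t *: x + (1 - t) *: y)) ->
  A `<=` B -> convex_hull A `<=` B.
Proof. by move=> /convex_setP cB AB; apply: smallest_sub. Qed.

(** The face of a convex hull is controlled by the generators on it: the points
    below level m, together with the points of a convex set B at level m, form
    a convex set. The instances B = singleton, empty set and line give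
    respectively that maximality can be tested on generators, that vertices
    are generators, and that a face with collinear generators is an edge. *)
Lemma convex_hull_top A B c (m : R) :
    (forall (t : R) x y, 0 <= t <= 1 -> B x -> B y -> B (t *: x + (1 - t) *: y)) ->
    (forall x, A x -> dotp c x < m \/ dotp c x = m /\ B x) ->
  forall x, convex_hull A x -> dotp c x < m \/ dotp c x = m /\ B x.
Proof.
move=> cB AB; apply: (@convex_hull_min A (fun x => _ \/ _)) => //.
move=> t x y t01 Hx Hy; have /andP[t0 t1] := t01.
have [t00|tn0] := eqVneq t 0; first by rewrite t00 scale0r add0r subr0 scale1r.
have [t11|tn1] := eqVneq t 1; first by rewrite t11 scale1r subrr scale0r addr0.
have tp : 0 < t by rewrite lt0r tn0.
have tq : 0 < 1 - t by rewrite subr_gt0 lt_neqAle tn1.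
rewrite !dotpE; case: Hx => [xm|[xm Bx]].
  left; have ym : dotp c y <= m by case: Hy => [/ltW|[->]].
  nra.
case: Hy => [ym|[ym By]]; first by left; nra.
by right; split; [rewrite xm ym; ring|apply: cB].
Qed.

Definition strict_max A c w :=
  A w /\ forall x, A x -> x <> w -> dotp c x < dotp c w.

Lemma strict_max_convex_hull A c w :
  strict_max A c w -> strict_max (convex_hull A) c w.
Proof.
move=> [Aw maxw]; split=> [|x Ax xw]; first exact: sub_convex_hull.
have [|y Ay|//|[_ /xw//]] := @convex_hull_top A [set w] c (dotp c w) _ _ x Ax.
  by move=> t y z _ -> ->; rewrite -scalerDl addrC subrK scale1r.
by have [->|] := pselect (y = w); [right|left; apply: maxw].
Qed.

Lemma strict_max_generators A c w :
  strict_max (convex_hull A) c w -> strict_max A c w.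
Proof.
move=> [Hw maxw]; split=> [|x /sub_convex_hull]; last exact: maxw.
apply: contrapT => Aw.
have [//|x Ax||[]//] := @convex_hull_top A set0 c (dotp c w) _ _ w Hw.
  left; apply: maxw; first exact: sub_convex_hull.
  by move=> xw; apply: Aw; rewrite -xw.
by rewrite ltxx.
Qed.

Lemma affine_hull_min A B : affine_set B -> A `<=` B -> affine_hull A `<=` B.
Proof. by move=> aB AB; apply: smallest_sub. Qed.

Lemma affine_hull_affine A : affine_set (affine_hull A).
Proof. by move=> t x y Ax Ay B BA; apply: BA.1; [apply: Ax|apply: Ay]. Qed.

Lemma sub_affine_hull A : A `<=` affine_hull A.
Proof. exact: sub_gen_smallest. Qed.

(** Reduces vertices to functionals: the dimension condition is automatic,
    since a singleton is its own affine hull. *)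
Lemma verticesP P w : vertices P w <-> exists c, strict_max P c w.
Proof.
split=> [[[c [b [Pb wE]]] _]|[c [Pw maxw]]].
  have : [set w] w by []. rewrite {1}wE => -[Pw /= wb].
  exists c; split=> // x Px xw; rewrite wb lt_neqAle Pb // andbT.
  by apply/eqP => xb; apply: xw; have : [set w] x by rewrite wE.
split.
  exists c, (dotp c w); split=> [x Px|].
    by have [->|/(maxw x Px)/ltW//] := pselect (x = w).
  apply/seteqP; split=> [x ->//|x [Px /= cx]]; apply: contrapT => xw.
  by have := maxw x Px xw; rewrite cx ltxx.
exists w, 0%VS; split; last exact: dimv0.
apply/seteqP; split.
  apply: affine_hull_min => [t x y|x ->].
    move=> [u u0 <-] [v v0 <-]; exists 0; first by rewrite /= mem0v.
    move: u0 v0; rewrite /= !memv0 => /eqP-> /eqP->.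
    by rewrite !addr0 -scalerDl addrC subrK scale1r.
  by exists 0; rewrite /= ?mem0v ?addr0.
move=> x [u /=]; rewrite memv0 => /eqP-> <-; rewrite addr0.
exact: sub_affine_hull.
Qed.

(** The supporting functional cuts out a face contained in the line through u
    and v. As u and v are vertices, this face is an edge between them, and its
    affine hull is the whole line since u and v are distinct. *)
Lemma adjacent_of_collinear_top A c u v :
    vertices (convex_hull A) u -> vertices (convex_hull A) v -> u <> v ->
    dotp c v = dotp c u ->
    (forall x, A x -> dotp c x < dotp c u \/
       dotp c x = dotp c u /\ exists t, x = u + t *: (v - u)) ->
  adjacent (convex_hull A) u v.
Proof.
set P := convex_hull A => Pu Pv uv cuv Atop.
pose line := [set x | exists t, x = u + t *: (v - u)].
have aline (t : R) x y : line x -> line y -> line (t *: x + (1 - t) *: y).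
  move=> [a ->] [b ->]; exists (t * a + (1 - t) * b).
  by apply/rowP => i; rewrite !mxE; ring.
have Ptop x : P x -> dotp c x < dotp c u \/ dotp c x = dotp c u /\ line x.
  by apply: convex_hull_top => // t y z _; apply: aline.
have inP w : vertices P w -> P w by move/verticesP => [? []].
pose F := P `&` [set x | dotp c x = dotp c u].
have Fu : F u by split=> //; apply: inP.
have Fv : F v by split=> //; apply: inP.
split=> //; exists F => //; split.
  by exists c, (dotp c u); split=> // x /Ptop[/ltW|[->]].
exists u, <[v - u]>%VS; split; last first.
  by rewrite dim_vline subr_eq0; case: eqVneq => // /esym/uv.
apply/seteqP; split=> x.
  move=> Fx; have : line x.
    apply: affine_hull_min Fx; first by move=> t y z; apply: aline.
    by move=> y [/Ptop[|[_ //]] /[swap] /= ->]; rewrite ltxx.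
  by move=> [t ->]; exists (t *: (v - u)) => //=; rewrite memvZ ?memv_line.
move=> [w /= /vlineP[t ->] <-].
have -> : u + t *: (v - u) = t *: v + (1 - t) *: u.
  by apply/rowP => i; rewrite !mxE; ring.
by apply: affine_hull_affine; apply: sub_affine_hull.
Qed.

(** A third vertex w on the edge through u and v would make three collinear
    points, one of which lies strictly between the other two, and the middle
    one cannot be the unique maximizer of any functional. *)
Lemma adjacent_supporting P u v : adjacent P u v ->
  exists2 c, dotp c v = dotp c u &
    forall w, vertices P w -> w <> u -> w <> v -> dotp c w < dotp c u.
Proof.
move=> [Pu Pv uv [F [[c [b [Pb FE]]] [x [U [HU dU]]]] [Fu Fv]]].
have cu : dotp c u = b by move: Fu; rewrite FE => -[].
have cv : dotp c v = b by move: Fv; rewrite FE => -[].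
exists c => [|w Pw wu wv]; first by rewrite cu.
have /verticesP[cw [Pw' maxw]] := Pw.
rewrite cu lt_neqAle Pb // andbT; apply/eqP => cwb.
have Fw : F w by rewrite FE.
have inU y : F y -> y - x \in U.
  move=> /sub_affine_hull; rewrite HU => -[z /= zU <-].
  by rewrite addrC addKr.
have inUB y z : F y -> F z -> z - y \in U.
  move=> Fy Fz; have -> : z - y = (z - x) - (y - x) by rewrite opprB addrA subrK.
  by rewrite memvB ?inU.
have UE : <[v - u]>%VS = U.
  apply/eqP; rewrite eqEdim -memvE inUB //= dU dim_vline subr_eq0.
  by case: eqVneq => // /esym/uv.
have : w - u \in U by apply: inUB.
rewrite -UE => /vlineP[t]; move/(canRL (subrK u)) => wE.
have/verticesP[cu' [Pu' maxu]] := Pu; have/verticesP[cv' [Pv' maxv]] := Pv.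
have := maxu _ Pw' wu; have := maxu _ Pv' (nesym uv).
have := maxv _ Pw' wv; have := maxv _ Pu' uv.
have := maxw _ Pu' (nesym wu); have := maxw _ Pv' (nesym wv).
(* With w = u + t (v - u), exposing u forces 0 < t and exposing v forces
   t < 1; then w is between u and v and is not exposed. *)
rewrite wE !dotpE => w1 w2 v1 v2 u1 u2.
have t0 : 0 < t by nra.
have t1 : 0 < 1 - t by nra.
have : 0 < t * (dotp cw v - dotp cw u) by lra.
have : 0 < (1 - t) * (dotp cw u - dotp cw v) by lra.
by rewrite !pmulr_rgt0 // !subr_gt0 // => w2' /lt_trans/(_ w2'); rewrite ltxx.
Qed.

End Faces.

(** * Shadow vertex paths *)

Definition edge {R : realType} {n : nat} (P : set 'rV[R]_n) : rel 'rV[R]_n :=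
  fun u v => `[< adjacent P u v >].

Section ShadowPath.
Context {R : realType} {n : nat}.
Local Notation E := 'rV[R]_n.
Implicit Types (c d x y w : E) (L Z W : seq E).

Variables (W L : seq E) (c0 d wmax : E).
Hypothesis c0L : positive_on L c0.
Hypothesis dL : positive_on L d.
Hypothesis d_max : strict_max [set` W] d wmax.
Hypothesis d_sep : forall x y, x \in W -> y \in W -> x <> y -> dotp d x != dotp d y.
Hypothesis d_gen : forall w x y, w \in W -> x \in W -> y \in W ->
  let z := dotp c0 (x - w) *: (y - w) - dotp c0 (y - w) *: (x - w) in
  z != 0 -> dotp d z != 0.

Let ray (t : R) := c0 + t *: d.

(* Position of the pivoting process: w maximizes the functional at time t, and
   d decides between the maximizers. This makes w the maximizer just after
   time t without choosing a small increment. *)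
Let lex_max t w := w \in W /\ forall x, x \in W -> x <> w ->
  dotp (ray t) x < dotp (ray t) w \/
  dotp (ray t) x = dotp (ray t) w /\ dotp d x < dotp d w.

(** Just after time t, the functional breaks the ties at time t in favour of d. *)
Lemma lex_max_exposed t w : 0 <= t -> lex_max t w ->
  exists2 c, positive_on L c & strict_max (convex_hull [set` W]) c w.
Proof.
move=> t0 [wW maxw].
have [x|e e0 /(_ e)] := @lex_perturbation _ _
    (L ++ [seq w - x | x <- W & x != w]) (ray t) d.
  rewrite mem_cat => /orP[xL|/mapP[y]].
    by left; rewrite !dotpE ltr_wpDr ?c0L // mulr_ge0 // ltW ?dL.
  rewrite mem_filter => /andP[/eqP yw yW] ->; rewrite !(dotpDr _ w) !dotpNr.
  rewrite !subr_gt0; case: (maxw y yW yw) => [|[-> ?]]; [by left|right].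
  by rewrite subrr.
rewrite e0 lexx => /(_ isT) cpos; exists (ray t + e *: d).
  by move=> x xL; apply: cpos; rewrite mem_cat xL.
apply: strict_max_convex_hull; split=> // x xW xw.
have /cpos : w - x \in L ++ [seq w - x | x <- W & x != w].
  rewrite mem_cat; apply/orP; right; apply: map_f.
  by rewrite mem_filter xW andbT; apply/eqP.
by rewrite dotpDr dotpNr subr_gt0.
Qed.

(** One pivot. Only points with a larger value of d can overtake w; the first
    one to do so determines the next time t', and the new vertex is the highest
    for d among the points tied with w at time t'. All the tied points lie on
    one line by genericity, so the pivot follows an edge. *)
Lemma shadow_step t w : 0 <= t -> lex_max t w -> w <> wmax ->
  exists t' w', [/\ 0 <= t', lex_max t' w',
    adjacent (convex_hull [set` W]) w w' & dotp d w < dotp d w'].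
Proof.
move=> t0 lexw wmaxN; have [wW maxw] := lexw.
pose C := [seq x <- W | dotp d w < dotp d x].
(* The time at which x catches up with w. *)
pose T x := (dotp c0 w - dotp c0 x) / (dotp d x - dotp d w).
have [|v vC vmin] := @seq_argmin _ _ T C.
  rewrite -has_filter; apply/hasP; exists wmax; first by case: d_max.
  by case: d_max => _; apply.
pose t' := T v; have dC x : x \in C -> 0 < dotp d x - dotp d w.
  by rewrite mem_filter subr_gt0 => /andP[].
have tt' : t < t'.
  rewrite ltr_pdivlMr ?dC //; move: (vC); rewrite mem_filter => /andP[dv vW].
  have vw : v <> w by move=> vw; rewrite vw ltxx in dv.
  case: (maxw v vW vw) => [|[_ dv']]; first by rewrite !dotpE; lra.
  by have := lt_trans dv dv'; rewrite ltxx.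
have le_t' x : x \in W -> dotp (ray t') x <= dotp (ray t') w.
  move=> xW; have [->//|/eqP xw] := eqVneq x w.
  have := d_sep xW wW xw; rewrite neq_lt => /orP[dx|dx].
    have : dotp (ray t) x <= dotp (ray t) w.
      by case: (maxw x xW xw) => [/ltW//|[->]].
    by rewrite !dotpE; nra.
  have xC : x \in C by rewrite mem_filter dx.
  by have := vmin x xC; rewrite -/t' ler_pdivlMr ?dC // !dotpE; lra.
pose tied := [seq x <- W | dotp (ray t') x == dotp (ray t') w].
have v_tied : v \in tied.
  move: (vC); rewrite !mem_filter => /andP[dv ->]; rewrite andbT; apply/eqP.
  have : t' * (dotp d v - dotp d w) = dotp c0 w - dotp c0 v.
    by rewrite divfK // gt_eqF // dC.
  by rewrite !dotpE; lra.
have [|w' w'_tied w'max] := @seq_argmin _ _ (fun x => - dotp d x) tied.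
  by apply: contraTneq v_tied => ->.
have dw' : dotp d w < dotp d w'.
  have := w'max v v_tied; rewrite lerN2; apply: lt_le_trans.
  by move: vC; rewrite mem_filter => /andP[].
move: w'_tied; rewrite mem_filter => /andP[/eqP w'tied w'W].
have ww' : w <> w' by move=> ww'; rewrite ww' ltxx in dw'.
have lexw' : lex_max t' w'.
  split=> // x xW xw'; have := le_t' x xW.
  rewrite le_eqVlt w'tied => /orP[xtied|]; last by left.
  right; split; first exact/eqP.
  rewrite lt_neqAle d_sep //= -lerN2; apply: w'max.
  by rewrite mem_filter xtied.
have t'0 : 0 <= t' by apply: le_trans t0 (ltW tt').
exists t', w'; split=> //.
apply: (@adjacent_of_collinear_top _ _ _ (ray t')) => //.
- by apply/verticesP; have [c _ maxc] := lex_max_exposed t0 lexw; exists c.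
- by apply/verticesP; have [c _ maxc] := lex_max_exposed t'0 lexw'; exists c.
move=> x /= xW; have := le_t' x xW; rewrite le_eqVlt => /orP[/eqP xtied|]; last by left.
right; split=> //.
(* On differences of tied points, c0 is - t' times d, so d vanishes on the
   combination z below; genericity of d makes z itself vanish. *)
have Ex : dotp c0 (x - w) = - t' * dotp d (x - w).
  by move: xtied; rewrite !dotpE; lra.
have Ew' : dotp c0 (w' - w) = - t' * dotp d (w' - w).
  by move: w'tied; rewrite !dotpE; lra.
pose z := dotp c0 (w' - w) *: (x - w) - dotp c0 (x - w) *: (w' - w).
have /eqP z0 : z == 0.
  apply: contraT => /(d_gen wW w'W xW)/eqP[].
  by rewrite Ex Ew' [LHS]dotpDr dotpNr 2!(dotpZr d); ring.
have c0w' : dotp c0 (w' - w) != 0.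
  have t'_neq0 : t' != 0 by rewrite gt_eqF // (le_lt_trans t0).
  have dw'_neq0 : dotp d (w' - w) != 0.
    by rewrite gt_eqF // dotpDr dotpNr subr_gt0.
  by rewrite Ew' mulNr oppr_eq0 mulf_neq0.
exists (dotp c0 (x - w) / dotp c0 (w' - w)).
have/eqP := z0; rewrite subr_eq0 => /eqP zE.
by rewrite mulrC -scalerA -zE scalerA mulVf // scale1r addrC subrK.
Qed.

(** Each pivot increases the value of d, hence decreases the number of points
    that are higher than the current one for d. *)
Lemma shadow_path_from t w : 0 <= t -> lex_max t w ->
  exists s, [/\ path (edge (convex_hull [set` W])) w s, last w s = wmax &
    forall x, x \in w :: s ->
      exists2 c, positive_on L c & strict_max (convex_hull [set` W]) c x].
Proof.
have [k] := ubnP (count (fun x => dotp d w < dotp d x) W).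
elim: k t w => // k IH t w; rewrite ltnS => leWk t0 lexw.
have exw := lex_max_exposed t0 lexw.
have [<-|/eqP wN] := eqVneq w wmax.
  by exists [::]; split=> // x; rewrite inE => /eqP->.
have [t' [w' [t'0 lexw' adj dw']]] := shadow_step t0 lexw wN.
have [|s [ps ls exs]] := IH t' w' _ t'0 lexw'.
  apply: leq_trans leWk; rewrite -addn1.
  set a := fun x => dotp d w' < dotp d x; set b := fun x => dotp d w < dotp d x.
  have <- : count a W + count (predI b (predC a)) W = count b W.
    rewrite -[LHS]count_predUI (_ : count (predI a _) W = 0)%N ?addn0.
      apply: eq_count => x; rewrite /= /a /b.
      by case: (ltP (dotp d w') (dotp d x)) => [/(lt_trans dw')->|]; rewrite ?andbT.
    rewrite (@eq_count _ _ pred0) ?count_pred0 // => x /=.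
    by case: (a x); rewrite ?andbF.
  rewrite leq_add2l -has_count; apply/hasP; exists w'; first by case: lexw'.
  by rewrite /= /a /b dw' ltxx.
exists (w' :: s); split=> //=; first by rewrite ps andbT; apply/asboolP.
by move=> x; rewrite inE => /predU1P[->|/exs].
Qed.

End ShadowPath.

(** The target c1 is perturbed to a functional d that stays in the cone, keeps
    w1 as unique maximizer, separates the points of W and is nonzero on every
    nonzero combination (c0 . x) y - (c0 . y) x of differences x, y of points of
    W. The last condition rules out that three affinely independent points
    are tied at the same positive time: x and y would then both be killed by
    c0 + t d, so d would vanish on this combination, which must then be zero;
    but d, hence c0, is nonzero on x and y, so they would be proportional. *)
Lemma shadow_path (R : realType) (n : nat) (W L : seq 'rV[R]_n) c0 c1 w0 w1 :
    positive_on L c0 -> positive_on L c1 ->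
    strict_max (convex_hull [set` W]) c0 w0 ->
    strict_max (convex_hull [set` W]) c1 w1 ->
  exists s, [/\ path (edge (convex_hull [set` W])) w0 s, last w0 s = w1 &
    forall x, x \in w0 :: s ->
      exists2 c, positive_on L c & strict_max (convex_hull [set` W]) c x].
Proof.
move=> c0L c1L /strict_max_generators[w0W max0] /strict_max_generators[w1W max1].
pose D := [seq x - y | x <- W, y <- W].
pose D2 := [seq dotp c0 x *: y - dotp c0 y *: x | x <- D, y <- D].
pose Z := [seq z <- D ++ D2 | z != 0].
pose L1 := L ++ [seq w1 - x | x <- W & x != w1].
have inD x y : x \in W -> y \in W -> x - y \in D.
  by move=> xW yW; apply/allpairsP; exists (x, y).
have [||d dL1 dZ] := @generic_perturbation _ _ L1 Z c1.
- move=> x; rewrite mem_cat => /orP[/c1L//|/mapP[y]].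
  rewrite mem_filter => /andP[/eqP yw yW] ->.
  by rewrite dotpDr dotpNr subr_gt0 max1.
- by rewrite mem_filter eqxx.
apply: (@shadow_path_from _ _ W L c0 d w1 _ _ _ _ _ 0) => //.
- by move=> x xL; apply: dL1; rewrite mem_cat xL.
- split=> // x xW xw; have /dL1 : w1 - x \in L1.
    rewrite mem_cat; apply/orP; right; apply: map_f.
    by rewrite mem_filter xW andbT; apply/eqP.
  by rewrite dotpDr dotpNr subr_gt0.
- move=> x y xW yW xy; rewrite -subr_eq0 -dotpNr -dotpDr; apply: dZ.
  by rewrite mem_filter subr_eq0 mem_cat inD // andbT; apply/eqP.
- move=> w x y wW xW yW z z0; apply: dZ; rewrite mem_filter z0 mem_cat.
  by apply/orP; right; apply/allpairsP; exists (x - w, y - w); rewrite ?inD.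
- split=> // x xW xw; rewrite scale0r addr0; left; exact: max0.
Qed.

(** * Vertices of Minkowski sums *)

Section MinkowskiVertices.
Context {R : realType} {n : nat}.
Local Notation E := 'rV[R]_n.
Implicit Types (P Q : set E) (c u v w x : E) (V W L : seq E).

Lemma vertex_generator V v : vertices (convex_hull [set` V]) v -> v \in V.
Proof. by move/verticesP => [c /strict_max_generators[]]. Qed.

Lemma finite_vertices P : polytope P -> finite_set (vertices P).
Proof.
move=> [V _ ->]; apply: (@sub_finite_set _ _ [set` V]); last exact: finite_seq.
exact: vertex_generator.
Qed.

Lemma size_le_f0 P (s : seq E) : polytope P -> uniq s ->
  (forall x, x \in s -> vertices P x) -> (size s <= f0 P)%N.
Proof.
move=> polyP us sP; apply: uniq_leq_size => // x /sP Px.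
by rewrite in_fset_set ?inE //; exact: finite_vertices.
Qed.

(** One inclusion fixes first a generator of the second hull, then a point of
    the first hull, and uses each time that a translate of a convex set is
    convex. *)
Lemma minkowski_sum_convex_hull V W :
  minkowski_sum (convex_hull [set` V]) (convex_hull [set` W]) =
  convex_hull [set` [seq v + w | v <- V, w <- W]].
Proof.
have ccomb (t : R) x y a b :
    t *: (x + a) + (1 - t) *: (y + b) =
    (t *: x + (1 - t) *: y) + (t *: a + (1 - t) *: b).
  by rewrite !scalerDr addrACA.
have cdup (t : R) (a : E) : t *: a + (1 - t) *: a = a.
  by rewrite -scalerDl addrC subrK scale1r.
apply/seteqP; split=> x; last first.
  apply: convex_hull_min => [t y z t01|y /=].
    move=> [a Va [b Wb <-]] [a' Va' [b' Wb' <-]].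
    exists (t *: a + (1 - t) *: a'); first exact: convex_hull_convex.
    by exists (t *: b + (1 - t) *: b'); [exact: convex_hull_convex|].
  by move=> /allpairsP[[v w] /= [vV wW ->]];
    exists v; [exact: sub_convex_hull|exists w; [exact: sub_convex_hull|]].
move=> [p Vp [q Wq <-]].
set S := convex_hull _.
have Sp w : w \in W -> S (p + w).
  move=> wW; apply: (@convex_hull_min _ _ _ (fun p => S (p + w))) Vp.
    move=> t y z t01 Sy Sz; rewrite -(cdup t w) -ccomb.
    exact: convex_hull_convex.
  move=> v vV; apply: sub_convex_hull; rewrite /=.
  by apply/allpairsP; exists (v, w).
apply: (@convex_hull_min _ _ _ (fun q => S (p + q))) Wq; last exact: Sp.
move=> t y z t01 Sy Sz; rewrite -(cdup t p) -ccomb.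
exact: convex_hull_convex.
Qed.

Lemma minkowski_sumC P Q : minkowski_sum P Q = minkowski_sum Q P.
Proof.
by apply/seteqP; split=> _ [p Pp [q Qq <-]]; exists q => //; exists p; rewrite // addrC.
Qed.

Lemma strict_max_unique P c u v : strict_max P c u -> strict_max P c v -> u = v.
Proof.
move=> [Pu maxu] [Pv maxv]; apply: contrapT => uv.
by have := lt_trans (maxv u Pu uv) (maxu v Pv (nesym uv)); rewrite ltxx.
Qed.

Lemma strict_max_add P Q c p q : strict_max P c p -> strict_max Q c q ->
  strict_max (minkowski_sum P Q) c (p + q).
Proof.
move=> [Pp maxp] [Qq maxq]; split; first by exists p => //; exists q.
move=> _ [p' Pp' [q' Qq' <-]] neq; rewrite !dotpDr.
have [p'p|/(maxp p' Pp')] := pselect (p' = p); last first.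
  have [->|/(maxq q' Qq')] := pselect (q' = q); lra.
by rewrite p'p ltrD2l; apply: maxq => // q'q; apply: neq; rewrite p'p q'q.
Qed.

Lemma strict_max_minkowski_sum P Q c w :
  strict_max (minkowski_sum P Q) c w ->
  exists p q, [/\ strict_max P c p, strict_max Q c q & w = p + q].
Proof.
move=> [[p Pp [q Qq <-]] maxw]; exists p, q; split=> //; split=> // x.
  move=> Px xp; have := maxw (x + q); rewrite !dotpDr ltrD2r; apply.
    by exists x => //; exists q.
  by move/addIr.
move=> Qx xq; have := maxw (p + x); rewrite !dotpDr ltrD2l; apply.
  by exists p => //; exists x.
by move/addrI.
Qed.

(** The vertices w of P + Q whose component in P is the vertex u; the functional
    c lies in the intersection of the normal cones of u and of w - u. *)
Definition vertex_over P Q u w := exists c q,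
  [/\ strict_max P c u, strict_max Q c q & w = u + q].

Lemma vertex_over_exists P Q w :
  vertices (minkowski_sum P Q) w ->
  exists2 u, vertices P u & vertex_over P Q u w.
Proof.
move/verticesP => [c /strict_max_minkowski_sum[p [q [maxp maxq ->]]]].
by exists p; [apply/verticesP; exists c|exists c, q].
Qed.

(** If u + q = u' + q' with u and q the unique maximizers of c and u' different
    from u, the right side would have a smaller value than the left side. *)
Lemma vertex_over_unique P Q u u' w :
  vertex_over P Q u w -> vertex_over P Q u' w -> u = u'.
Proof.
move=> [c [q [[Pu maxu] [Qq maxq] ->]]] [c' [q' [[Pu' _] [Qq' _] uq]]].
apply: contrapT => /nesym/(maxu u' Pu').
have : dotp c q' <= dotp c q.
  by have [->|/(maxq q' Qq')/ltW] := pselect (q' = q).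
have := congr1 (dotp c) uq; rewrite !dotpDr; lra.
Qed.

Lemma vertex_over_fiber P Q u w : vertex_over P Q u w -> vertices Q (w - u).
Proof.
by move=> [c [q [_ maxq ->]]]; rewrite addrC addKr; apply/verticesP; exists c.
Qed.

Lemma strict_max_of_separating V c : V != [::] ->
    (forall x y, x \in V -> y \in V -> x <> y -> dotp c x != dotp c y) ->
  exists u, strict_max (convex_hull [set` V]) c u.
Proof.
move=> V0 csep; have [u uV umax] := @seq_argmin _ _ (fun x => - dotp c x) V V0.
exists u; apply: strict_max_convex_hull; split=> // x xV xu.
by rewrite lt_neqAle csep //= -lerN2 umax.
Qed.

(** A functional in an open cone can be perturbed within the cone so as to
    separate the generators of both polytopes; its maximizers are then
    vertices. *)
Lemma generic_vertices P Q L c : polytope P -> polytope Q -> positive_on L c ->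
  exists c' u q, [/\ positive_on L c', strict_max P c' u & strict_max Q c' q].
Proof.
move=> [V V0 ->] [W W0 ->] cL.
pose D V := [seq z <- [seq x - y | x : E <- V, y : E <- V] | z != 0].
have [|c' c'L c'D] := @generic_perturbation _ _ L (D V ++ D W) c cL.
  by rewrite mem_cat !mem_filter eqxx.
have sep X : {subset D X <= D V ++ D W} ->
    forall x y, x \in X -> y \in X -> x <> y -> dotp c' x != dotp c' y.
  move=> XVW x y xX yX /eqP xy; rewrite -subr_eq0 -dotpNr -dotpDr.
  apply/c'D/XVW; rewrite mem_filter subr_eq0 xy.
  by apply/allpairsP; exists (x, y).
have [|u maxu] := strict_max_of_separating V0 (sep V _).
  by move=> z zV; rewrite mem_cat zV.
have [|q maxq] := strict_max_of_separating W0 (sep W _).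
  by move=> z zW; rewrite mem_cat zW orbT.
by exists c', u, q.
Qed.

(** The open normal cone of u in P is the open cone of the functionals positive
    on all u - v, for v a generator of P other than u. A shadow path in this
    cone stays over u, and a simple path over u injects into the vertices of Q
    by subtracting u. *)
Lemma fiber_path P Q u w w' : polytope P -> polytope Q ->
    vertex_over P Q u w -> vertex_over P Q u w' ->
  exists s, [/\ path (edge (minkowski_sum P Q)) w s, last w s = w' &
    ((size s).+1 <= f0 Q)%N].
Proof.
move=> polyP polyQ [c [q [maxu maxq ->]]] [c' [q' [maxu' maxq' ->]]].
have [V V0 PE] := polyP; have [W W0 QE] := polyQ.
pose L := [seq u - v | v <- V & v != u].
have posL d : strict_max P d u -> positive_on L d.
  move=> [_ dmax] x /mapP[v]; rewrite mem_filter => /andP[/eqP vu vV] ->.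
  rewrite dotpDr dotpNr subr_gt0; apply: dmax => //.
  by rewrite PE; apply: sub_convex_hull.
have uV : u \in V by apply: vertex_generator; rewrite -PE; apply/verticesP; exists c.
have Lmax d : positive_on L d -> strict_max P d u.
  move=> dL; rewrite PE; apply: strict_max_convex_hull; split=> // v vV vu.
  rewrite -subr_gt0 -dotpNr -dotpDr; apply: dL; apply: map_f.
  by rewrite mem_filter vV andbT; apply/eqP.
have maxw := strict_max_add maxu maxq.
have maxw' := strict_max_add maxu' maxq'.
move: (maxw) (maxw'); rewrite PE QE minkowski_sum_convex_hull.
move=> /(shadow_path (posL c maxu) (posL c' maxu'))/[apply].
rewrite -minkowski_sum_convex_hull -PE -QE => -[s [ps <- exs]].
have overs x : x \in (u + q) :: s -> vertex_over P Q u x.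
  move=> /exs[d /Lmax umax /strict_max_minkowski_sum[p [r [pmax rmax ->]]]].
  by rewrite (strict_max_unique pmax umax); exists d, r.
case/shortenP: ps => s' ps' us' ss'; exists s'; split=> //.
rewrite -[_.+1]/(size (u + q :: s')) -(size_map (fun x => x - u)).
apply: size_le_f0 => //; first by rewrite map_inj_uniq // => x y /addIr.
move=> _ /mapP[x xs' ->]; apply: (@vertex_over_fiber P); apply: overs.
by move: xs'; rewrite !inE => /predU1P[->|/ss' ->]; rewrite ?eqxx ?orbT.
Qed.

(** The cone L singles out u and v among the vertices of P. It contains the
    functional c that supports the edge uv, hence also functionals slightly
    tilted towards u - v and towards v - u, whose maximizers are u and v. A
    shadow path of P + Q from the first to the second changes from vertices
    over u to vertices over v at some edge. *)
Lemma edge_lift P Q u v : polytope P -> polytope Q -> adjacent P u v ->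
  exists a b, [/\ vertex_over P Q u a, vertex_over P Q v b &
    edge (minkowski_sum P Q) a b].
Proof.
move=> polyP polyQ adj; have [V V0 PE] := polyP; have [W W0 QE] := polyQ.
have [Pu Pv uv _] := adj; have [c cuv ctop] := adjacent_supporting adj.
pose others := [seq x <- V | [&& `[< vertices P x >], x != u & x != v]].
pose L := [seq u - x | x <- others] ++ [seq v - x | x <- others].
have othersP x : x \in others <-> [/\ vertices P x, x <> u & x <> v].
  rewrite mem_filter; split.
    by move=> /andP[/and3P[/asboolP Px /eqP xu /eqP xv] _].
  move=> [Px /eqP-> /eqP->]; rewrite !andbT; apply/andP; split.
    exact/asboolP.
  by apply: vertex_generator; rewrite -PE.
have cL : positive_on L c.
  move=> x; rewrite mem_cat => /orP[] /mapP[y /othersP[Py yu yv] ->].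
    by rewrite dotpDr dotpNr subr_gt0 ctop.
  by rewrite dotpDr dotpNr subr_gt0 cuv ctop.
have Lvert d p : positive_on L d -> strict_max P d p -> p = u \/ p = v.
  move=> dL maxp; apply: contrapT => /not_orP[pu pv].
  have : u - p \in L.
    rewrite mem_cat; apply/orP; left; apply/map_f/othersP; split=> //.
    by apply/verticesP; exists d.
  move/dL; rewrite dotpDr dotpNr subr_gt0; apply/negP; rewrite -leNgt ltW //.
  have/verticesP[? [Pu' _]] := Pu.
  by case: maxp => _; apply=> //; apply: nesym.
(* Tilting c towards x - y makes x the winner between the two ends. *)
have corner x y : (x = u /\ y = v) \/ (x = v /\ y = u) ->
    exists d q, [/\ positive_on L d, strict_max P d x & strict_max Q d q].
  move=> xy; have [z|e e0 /(_ e)] := @lex_perturbation _ _ ((x - y) :: L) c (x - y).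
    rewrite inE => /predU1P[->|/cL]; [right|by left].
    split; last by apply: dotp_gt0; rewrite subr_eq0; case: xy => -[-> ->];
      [exact/eqP|apply/eqP/nesym].
    by rewrite dotpDr dotpNr; case: xy => -[-> ->]; rewrite cuv subrr.
  rewrite e0 lexx => /(_ isT)/(generic_vertices polyP polyQ).
  move=> [d [p [q [dL maxp maxq]]]]; exists d, q.
  have dL' : positive_on L d by move=> z zL; apply: dL; rewrite inE zL orbT.
  split=> //; suff <- : p = x by [].
  apply: contrapT => px; have py : p = y.
    by case: (Lvert d p dL' maxp) (xy) px => -> [[-> ->]|[-> ->]].
  have : x - y \in x - y :: L by rewrite inE eqxx.
  move/dL; rewrite dotpDr dotpNr subr_gt0; apply/negP; rewrite -leNgt ltW //.
  rewrite py in maxp; case: maxp => _; apply; last by rewrite -py; exact: nesym.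
  by case: xy => -[-> _]; [have/verticesP[? []] := Pu|have/verticesP[? []] := Pv].
have [d0 [q0 [d0L maxu maxq0]]] := corner u v (or_introl (conj erefl erefl)).
have [d1 [q1 [d1L maxv maxq1]]] := corner v u (or_intror (conj erefl erefl)).
have := strict_max_add maxv maxq1; have := strict_max_add maxu maxq0.
rewrite PE QE minkowski_sum_convex_hull => /(shadow_path d0L d1L)/[apply].
rewrite -minkowski_sum_convex_hull -PE -QE => -[s [ps lasts exs]].
apply: (path_crossing (A := vertex_over P Q u) (B := vertex_over P Q v) ps).
- by exists d0, q0.
- by rewrite lasts; exists d1, q1.
- move=> x /exs[d dL /strict_max_minkowski_sum[p [q [maxp maxq ->]]]].
  by case: (Lvert d p dL maxp) => <-; [left|right]; exists d, q.
- by move=> y yu /(vertex_over_unique yu).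
Qed.

(** The path over P visits (size s).+1 vertices, and the lifted path spends at
    most f0 Q vertices over each of them. *)
Lemma path_lift P Q u s w w' : polytope P -> polytope Q ->
    path (edge P) u s ->
    vertex_over P Q u w -> vertex_over P Q (last u s) w' ->
  exists t, [/\ path (edge (minkowski_sum P Q)) w t, last w t = w' &
    ((size t).+1 <= (size s).+1 * f0 Q)%N].
Proof.
move=> polyP polyQ; elim: s u w => [|v s IH] u w /=.
  by move=> _ wu w'u; rewrite mul1n; apply: fiber_path wu w'u.
move=> /andP[/asboolP adj ps] wu w's.
have [a [b [au bv eab]]] := edge_lift polyP polyQ adj.
have [t1 [pt1 lt1 st1]] := fiber_path polyP polyQ wu au.
have [t2 [pt2 lt2 st2]] := IH v b ps bv w's.
exists (t1 ++ b :: t2); split.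
- by rewrite cat_path pt1 /= lt1 eab.
- by rewrite last_cat.
- by rewrite size_cat -addSn mulSn leq_add.
Qed.

(** Connectedness of the graph: a shadow path in the cone of all functionals,
    made simple to bound its length. *)
Lemma edge_path_exists P u v : polytope P -> vertices P u -> vertices P v ->
  exists s, [/\ path (edge P) u s, last u s = v & (size s <= f0 P)%N].
Proof.
move=> polyP Pu Pv; have [V V0 PE] := polyP.
have/verticesP[c maxu] := Pu; have/verticesP[d maxv] := Pv.
have nilP e : @positive_on R n [::] e by move=> x; rewrite in_nil.
move: maxu maxv; rewrite PE => /(shadow_path (nilP c) (nilP d))/[apply].
rewrite -PE => -[s [ps <- exs]].
case/shortenP: ps => s' ps' us' ss'; exists s'; split=> //.
apply: size_le_f0 => //; first by case/andP: us'.
move=> x /ss' xs; apply/verticesP.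
by have [|e _] := exs x; [rewrite inE xs orbT|exists e].
Qed.

End MinkowskiVertices.

(** * Graph distances and diameters *)

Section Diameter.
Context {R : realType}.
Local Open Scope ereal_scope.

Lemma graph_dist_le (T : eqType) (e : T -> T -> Prop) u v (s : seq T) :
    path (fun x y => `[< e x y >]) u s -> last u s = v ->
  graph_dist R e u v <= (size s)%:R%:E.
Proof. by move=> ps ls; apply: ereal_inf_lbound; exists s. Qed.

Lemma graph_dist_attained (T : eqType) (e : T -> T -> Prop) u v (s : seq T) :
    path (fun x y => `[< e x y >]) u s -> last u s = v ->
  exists t, [/\ path (fun x y => `[< e x y >]) u t, last u t = v &
    graph_dist R e u v = (size t)%:R%:E].
Proof.
move=> ps ls.
pose A k := `[< exists t,
  [/\ path (fun x y => `[< e x y >]) u t, last u t = v & size t = k] >].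
have exA : exists k, A k by exists (size s); apply/asboolP; exists s.
case: (ex_minnP exA) => k /asboolP[t [pt lt <-]] tmin; exists t; split=> //.
apply/eqP; rewrite eq_le graph_dist_le //=.
apply/ereal_infP => _ [r [pr lr] <-].
by rewrite lee_fin ler_nat; apply: tmin; apply/asboolP; exists r.
Qed.

(** The diameter is bounded above by connectedness, and it is nonnegative since
    there is at least one vertex. *)
Lemma diameter_fin_num (n : nat) (P : set 'rV[R]_n) :
  polytope P -> diameter P \is a fin_num.
Proof.
move=> polyP; rewrite fin_numE; apply/andP; split; last first.
  rewrite -ltey; apply: (@le_lt_trans _ _ (f0 P)%:R%:E); last exact: ltey.
  apply/ereal_supP => _ [u Pu [v Pv <-]].
  have [s [ps ls sf]] := edge_path_exists polyP Pu Pv.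
  by apply: le_trans (graph_dist_le ps ls) _; rewrite lee_fin ler_nat.
have [|c [u [_ [_ maxu _]]]] := @generic_vertices R n P P [::] 0 polyP polyP.
  by move=> x; rewrite in_nil.
have Pu : vertices P u by apply/verticesP; exists c.
rewrite -ltNye; apply: (@lt_le_trans _ _ 0); first exact: ltNy0.
apply: (@le_trans _ _ (graph_dist R (adjacent P) u u)).
  by apply/ereal_infP => _ [s _ <-]; rewrite lee_fin.
by apply: ereal_sup_ubound; exists u => //; exists u.
Qed.

Lemma diameter_minkowski_sum_lt (n : nat) (P Q : set 'rV[R]_n) :
    polytope P -> polytope Q ->
  diameter (minkowski_sum P Q) < (diameter P + 1) * (f0 Q)%:R%:E.
Proof.
move=> polyP polyQ; have DP := diameter_fin_num polyP.
set D := fine (diameter P); have DE : diameter P = D%:E by rewrite fineK.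
rewrite DE -EFinD -EFinM.
apply: (@le_lt_trans _ _ ((D + 1) * (f0 Q)%:R - 1)%:E); last first.
  by rewrite lte_fin ltrBlDr ltrDl ltr01.
apply/ereal_supP => _ [w Sw [w' Sw' <-]].
have [u Pu wu] := vertex_over_exists Sw.
have [u' Pu' w'u'] := vertex_over_exists Sw'.
have [s0 [ps0 ls0 _]] := edge_path_exists polyP Pu Pu'.
have [s [ps ls sE]] := graph_dist_attained ps0 ls0.
have sD : ((size s)%:R <= D)%R.
  rewrite -lee_fin -sE -DE; apply: ereal_sup_ubound.
  by exists u => //; exists u'.
rewrite -ls in w'u'; have [t [pt lt st]] := path_lift polyP polyQ ps wu w'u'.
apply: le_trans (graph_dist_le pt lt) _; rewrite lee_fin lerBrDr natr1.
apply: (@le_trans _ _ ((size s).+1 * f0 Q)%N%:R); first by rewrite ler_nat.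
by rewrite natrM ler_wpM2r // -natr1 lerD2r.
Qed.

End Diameter.

Theorem theorem3p5 (R : realType) (n : nat) (P Q : set 'rV[R]_n) :
  polytope P -> polytope Q ->
  (diameter (minkowski_sum P Q) <
     Order.min ((diameter P + 1) * (f0 Q)%:R%:E)
               ((f0 P)%:R%:E * (diameter Q + 1)))%E.
Proof.
move=> polyP polyQ; rewrite lt_min diameter_minkowski_sum_lt //=.
by rewrite minkowski_sumC muleC diameter_minkowski_sum_lt.
Qed.
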